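(* Let $X$ be a Banach space satisfying the metric $\pi$-property and let $Y$ be a Banach space. (a) If $Y$ satisfies the metric $\pi$-property, then $\overline{\operatorname{NA}_\pi(X\widehat{\otimes}_\pi Y)}^{\|\cdot\|_\pi}=X\widehat{\otimes}_\pi Y$. (b) If $Y$ is uniformly convex, then $\overline{\operatorname{NA}_\pi(X\widehat{\otimes}_\pi Y)}^{\|\cdot\|_\pi}=X\widehat{\otimes}_\pi Y$.
   Context: Banach spaces are over $\mathbb{K}\in\{\mathbb{R},\mathbb{C}\}$. A Banach space $Z$ has the metric $\pi$-property if for every $\varepsilon>0$ and every finite collection $\{z_1,\ldots,z_n\}\subseteq S_Z$ of points of the unit sphere there is a finite dimensional $1$-complemented subspace $M\subseteq Z$ (i.e. $M$ is the range of a linear projection on $Z$ of norm at most $1$) such that for each $i\in\{1,\ldots,n\}$ there exists $z_i'\in M$ with $\|z_i-z_i'\|<\varepsilon$. $X \widehat{\otimes}_\pi Y$ is the projective tensor product, the completion of $X \otimes Y$ under $\|z\|_\pi = \inf\{\sum_{n=1}^\infty \|x_n\|\|y_n\| : z = \sum_{n=1}^\infty x_n \otimes y_n,\ \sum_n\|x_n\|\|y_n\|<\infty\}$. $\operatorname{NA}_\pi(X \widehat{\otimes}_\pi Y)$ is the set of $z$ which attain their projective norm, i.e. for which there is a bounded sequence $(x_n,y_n)\subseteq X\times Y$ with $\sum_n\|x_n\|\|y_n\|<\infty$, $z=\sum_n x_n\otimes y_n$ and $\|z\|_\pi=\sum_n\|x_n\|\|y_n\|$. *)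

(* Defs.v *)
From HB Require Import structures.
From mathcomp Require Import all_boot all_order all_algebra.
From mathcomp Require Import sesquilinear complex.
From mathcomp Require Import all_classical all_reals all_analysis.

Set Implicit Arguments.
Unset Strict Implicit.
Unset Printing Implicit Defensive.

Import Order.TTheory GRing.Theory Num.Theory.
Import numFieldTopology.Exports numFieldNormedType.Exports.

Local Open Scope classical_set_scope.
Local Open Scope ring_scope.

(* Norms of a [normedModType K] take their values in [K]. When [K] is [R[i]],
   the order is the partial order of MathComp, for which [0 < e] means that [e]
   is a positive real and two comparable elements have the same imaginary
   part. *)
Inductive real_or_complex (R : realType) : numFieldType -> Prop :=
| scalars_real : real_or_complex R R
| scalars_complex : real_or_complex R R[i].

Section GeometryOfBanachSpaces.
Variables (K : numFieldType) (Z : normedModType K).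

Definition unit_sphere : set Z := [set z | `|z| = 1].

Definition finite_dimensional (M : set Z) : Prop :=
  exists (d : nat) (e : 'I_d -> Z),
    M = [set z | exists a : 'I_d -> K, z = \sum_(i < d) a i *: e i].

Definition one_complemented (M : set Z) : Prop :=
  exists P : {linear Z -> Z},
    [/\ forall z, P (P z) = P z, forall z, `|P z| <= `|z| & range P = M].

Definition metric_pi_property : Prop :=
  forall (eps : K) (n : nat) (z : 'I_n -> Z),
    0 < eps -> (forall i, unit_sphere (z i)) ->
    exists M : set Z,
      [/\ finite_dimensional M, one_complemented M &
          forall i, exists2 z', M z' & `|z i - z'| < eps].

Definition uniformly_convex : Prop :=
  forall eps : K, 0 < eps <= 2 ->
    exists2 delta : K, 0 < delta &
      forall x y : Z, unit_sphere x -> unit_sphere y -> eps <= `|x - y| ->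
        `|2^-1 *: (x + y)| <= 1 - delta.

End GeometryOfBanachSpaces.

(* The algebraic tensor product is realised inside the linear functionals on
   the space of bilinear forms on [X * Y]: [x ⊗ y] is the evaluation
   [A |-> A x y], and [tensor X Y] is the linear span of these evaluations.
   Bilinear forms separate the points of an algebraic tensor product of vector
   spaces, so this has the usual universal property. *)
Section AlgebraicTensorProduct.
Variables (K : numFieldType) (X Y : lmodType K).

Local Notation form_functional := ({bilinear X -> Y -> K^o} -> K^o).

Definition evaluation (x : X) (y : Y) : form_functional := fun A => A x y.

Definition tensor_pred : {pred form_functional} :=
  [pred phi | `[< exists s : seq (X * Y),
                    phi = \sum_(p <- s) evaluation p.1 p.2 >]].

Lemma tensor_submod_closed : submod_closed tensor_pred.
Proof.
split; first by apply/asboolP; exists [::]; rewrite big_nil.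
move=> a u v /asboolP[s ->] /asboolP[t ->]; apply/asboolP.
exists ([seq (a *: p.1, p.2) | p <- s] ++ t).
rewrite big_cat big_map scaler_sumr; congr (_ + _).
by apply: eq_bigr => p _; apply/funext => A; rewrite /evaluation/= linearZl_LR.
Qed.

HB.instance Definition _ :=
  GRing.isSubmodClosed.Build K form_functional tensor_pred tensor_submod_closed.

Record tensor : Type := Tensor {
  tensor_val :> form_functional;
  tensor_valP : tensor_val \in tensor_pred }.

HB.instance Definition _ := [isSub for tensor_val].
HB.instance Definition _ := [Choice of tensor by <:].
HB.instance Definition _ := [SubChoice_isSubLmodule of tensor by <:].

Lemma evaluation_tensor x y : evaluation x y \in tensor_pred.
Proof. by apply/asboolP; exists [:: (x, y)]; rewrite big_seq1. Qed.

Definition elementary_tensor (x : X) (y : Y) : tensor :=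
  Tensor (evaluation_tensor x y).

End AlgebraicTensorProduct.

Notation "x ⊗ y" := (elementary_tensor x y) (at level 40, left associativity).

Section ProjectiveTensorProduct.
Variables (K : numFieldType) (X Y : normedModType K).

Definition finite_costs (u : tensor X Y) : set K :=
  [set c | exists2 s : seq (X * Y),
     u = \sum_(p <- s) p.1 ⊗ p.2 & c = \sum_(p <- s) `|p.1| * `|p.2|].

Variables (Z : normedModType K) (j : tensor X Y -> Z).

Definition series_representation (x : nat -> X) (y : nat -> Y) (z : Z) (c : K)
    : Prop :=
  series (fun n => j (x n ⊗ y n)) @ \oo --> z /\
  series (fun n => `|x n| * `|y n|) @ \oo --> c.

Definition series_costs (z : Z) : set K :=
  [set c | exists x y, series_representation x y z c].

(* [Z], with the canonical map [j], is the completion of [X ⊗ Y] for the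
   projective norm, [Z] being complete in the statements that use this. The
   field [projective_norm_series] follows from the other ones when [K] is the
   field of real or complex numbers; it cannot replace [projective_norm], as it
   is inherited by every quotient of [Z] by a closed subspace. *)
Record is_projective_tensor_product : Prop := {
  projective_linear : linear j;
  projective_dense : dense (range j);
  projective_norm : forall u, infimums (finite_costs u) `|j u|;
  projective_norm_series : forall z, infimums (series_costs z) `|z| }.

Definition norm_attaining : set Z :=
  [set z | exists x y,
     bounded_fun (fun n => (x n, y n)) /\ series_representation x y z `|z|].

End ProjectiveTensorProduct.

(* Main.v *)
Require Import Defs.
From HB Require Import structures.
From mathcomp Require Import all_boot all_order all_algebra.
From mathcomp Require Import sesquilinear complex.
From mathcomp Require Import all_classical all_reals all_analysis.
From mathcomp Require Import ring lra.

(** Finite sums of elementary tensors are dense, so it is enough to approximate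
    [u = \sum x ⊗ y]. The metric π-property of [X] gives a projection [P]
    of norm at most one with finite dimensional range, which moves the finitely
    many vectors [x] only a little; let [Q] be a similar projection of [Y] in case (a), and the
    identity of [Y] in case (b). Then [w = (P ⊗ Q) u] is close to [u]. As
    [P ⊗ Q] does not increase the cost of a representation and fixes [w], the
    norm of [w] is an infimum over representations [w = \sum x ⊗ y] with [x] in
    the range [M] of [P] and [y] in the range [N] of [Q].

    By the Hahn-Banach theorem there is a real linear functional [f] bounded by
    the norm with [f w = `|w|]. A representation of [w] of cost at most
    [`|w| + d] satisfies [\sum (`|x| `|y| - f (x ⊗ y)) <= d], with nonnegative
    terms. Hence the terms with [f (x ⊗ y) <= (1 - eta) `|x| `|y|] have total
    cost at most [d / eta], and can be dropped. The other terms nearly maximise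
    [f] among the elementary tensors of their size, and
    [near_exact_maximizer] moves each of them to a nearby [x' ⊗ y'] with
    [f (x' ⊗ y') = `|x'| `|y'|]. The resulting sum [w'] attains its projective
    norm, because [\sum `|x'| `|y'| = f w' <= `|w'| <= \sum `|x'| `|y'|]; this
    is [near_norm_attaining_sum].

    The number [eta] comes from compactness. Suppose that unit vectors [x_n] of
    [M] and [y_n] of [N] satisfy [f (x_n ⊗ y_n) --> 1]. Since [M] is finite
    dimensional, we may assume that [x_n --> x], and then [y_n] is a maximising
    sequence of the functional [f (x ⊗ _)], whose norm is at most one. Such a
    sequence has a convergent subsequence, by compactness if [N] is finite
    dimensional (case (a)), and because it is a Cauchy sequence if [Y] is
    uniformly convex (case (b)). The limit [x ⊗ y] is an exact maximiser.

    The last two steps only involve real functionals and real norms. They are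
    therefore carried out in real normed spaces, and applied over the scalar
    field [K] by restriction of scalars. *)

Set Implicit Arguments.
Unset Strict Implicit.
Unset Printing Implicit Defensive.

Import Order.TTheory GRing.Theory Num.Theory.
Import numFieldTopology.Exports numFieldNormedType.Exports.

Local Open Scope classical_set_scope.
Local Open Scope ring_scope.

(** * Restriction of scalars to the reals *)

(** What real and complex scalars have in common: [emb] embeds the reals as an
    ordered subfield which contains the values of all norms, [re] inverts it on
    nonnegative scalars, and [K] is spanned over the reals by [1] and
    [generator] (which is [0] for real scalars and [i] for complex ones). *)
Record real_scalars (R : realType) (K : numFieldType) := RealScalars {
  emb : {rmorphism R -> K};
  re : K -> R;
  ler_emb : {mono emb : a b / a <= b};
  reK : forall k, 0 <= k -> emb (re k) = k;
  generator : K;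
  scalar_decomposition : forall k, exists a b, k = emb a + emb b * generator }.

Lemma real_or_complex_scalars (R : realType) (K : numFieldType) :
  real_or_complex R K -> inhabited (real_scalars R K).
Proof.
case; constructor.
  apply: (@RealScalars _ _ (idfun : {rmorphism R -> R}) idfun _ _ 0) => //.
  by move=> k; exists k, 0; rewrite mulr0 addr0.
apply: (@RealScalars R R[i] (real_complex R : {rmorphism R -> R[i]})
  (@complex.Re R) _ _ 'i%C).
- by move=> a b; rewrite lecE /= eqxx.
- by move=> [a b]; rewrite lecE /= => /andP[/eqP -> _].
- by move=> [a b]; exists a, b; simpc.
Qed.

(** The space [V] with its scalars restricted to the reals; [S] is a parameter
    of the alias so that the real module structure can be found from the type. *)
Definition realified (R : realType) (K : numFieldType) (S : real_scalars R K)
    (V : Type) : Type := V.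

Section Realification.
Variables (R : realType) (K : numFieldType) (S : real_scalars R K).

Lemma ltr_emb : {mono emb S : a b / a < b}.
Proof. exact: leW_mono (ler_emb S). Qed.

Lemma norm_emb a : `|emb S a| = emb S `|a|.
Proof.
have [a0|a0] := leP 0 a.
  by rewrite !ger0_norm// -(rmorph0 (emb S)) ler_emb.
by rewrite !ltr0_norm ?rmorphN// -(rmorph0 (emb S)) ltr_emb.
Qed.

Lemma re_gt0 k : 0 < k -> 0 < re S k.
Proof. by move=> k0; rewrite -ltr_emb rmorph0 reK// ltW. Qed.

Section Lmodule.
Variable V : lmodType K.

HB.instance Definition _ := GRing.Zmodule.on (realified S V).

Definition real_scale (a : R) (v : realified S V) : realified S V := emb S a *: (v : V).

Fact real_scaleA a b v : real_scale a (real_scale b v) = real_scale (a * b) v.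
Proof. by rewrite /real_scale scalerA rmorphM. Qed.
Fact real_scale1 : left_id 1 real_scale.
Proof. by move=> v; rewrite /real_scale rmorph1 scale1r. Qed.
Fact real_scaleDr : right_distributive real_scale +%R.
Proof. by move=> a u v; rewrite /real_scale scalerDr. Qed.
Fact real_scaleDl v : {morph real_scale^~ v : a b / a + b}.
Proof. by move=> a b; rewrite /real_scale rmorphD scalerDl. Qed.

HB.instance Definition _ := GRing.Zmodule_isLmodule.Build R (realified S V)
  real_scaleA real_scale1 real_scaleDr real_scaleDl.
End Lmodule.

Section NormedModule.
Variable V : normedModType K.

Definition real_norm (v : realified S V) : R := re S `|v : V|.

Lemma emb_real_norm v : emb S (real_norm v) = `|v : V|.
Proof. by rewrite /real_norm reK. Qed.

Fact real_normD u v : real_norm (u + v) <= real_norm u + real_norm v.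
Proof. by rewrite -(ler_emb S) rmorphD !emb_real_norm ler_normD. Qed.

Fact real_normZ (a : R) (v : realified S V) :
  real_norm (a *: v) = `|a| * real_norm v.
Proof.
apply: (inc_inj (ler_emb S)).
by rewrite rmorphM !emb_real_norm -norm_emb -normrZ.
Qed.

Fact real_norm0_eq0 v : real_norm v = 0 -> v = 0.
Proof.
move=> v0; apply/eqP; rewrite -normr_eq0; apply/eqP.
by rewrite -emb_real_norm v0 rmorph0.
Qed.

HB.instance Definition _ := Lmodule_isNormed.Build R (realified S V)
  real_normD real_normZ real_norm0_eq0.
End NormedModule.

Lemma emb_norm (V : normedModType K) (v : realified S V) :
  emb S `|v| = `|v : V|.
Proof. exact: emb_real_norm. Qed.

Lemma emb_scale (V : lmodType K) (a : R) (v : realified S V) :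
  a *: v = emb S a *: (v : V).
Proof. by []. Qed.

Lemma realified_complete (V : completeNormedModType K)
    (F : set_system (realified S V)) : ProperFilter F -> cauchy F -> cvg F.
Proof.
move=> FF /cauchy_ballP Fc.
have : cvg (F : set_system V).
  apply/cauchy_cvgP/cauchy_ballP => e e0.
  have := Fc _ (re_gt0 e0); apply: filterS => -[x y] /=.
  rewrite -!ball_normE /= -ltr_emb emb_norm reK// ltW//.
move=> /cvg_ex[l Fl]; apply/cvg_ex; exists l.
apply/cvgrPdist_lt => e e0.
have e0' : 0 < emb S e by rewrite -(rmorph0 (emb S)) ltr_emb.
move/cvgrPdist_lt : Fl => /(_ _ e0').
by apply: filterS => x; rewrite -emb_norm ltr_emb.
Qed.

HB.instance Definition _ (V : completeNormedModType K) :=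
  Uniform_isComplete.Build (realified S V) (@realified_complete V).
End Realification.

(** * The Hahn-Banach theorem *)

Section HahnBanach.
Variables (R : realType) (V : lmodType R).
Implicit Types (p q : V -> R) (x y : V) (t : R).

(** The second clause, applied to [t] and [t^-1], gives positive homogeneity; an
    inequality is easier to check for an infimum. *)
Definition sublinear p :=
  (forall x y, p (x + y) <= p x + p y) /\
  (forall t x, 0 < t -> p (t *: x) <= t * p x).

Lemma sublinearZ p t x : sublinear p -> 0 < t -> p (t *: x) = t * p x.
Proof.
move=> [_ pZ] t0; apply/eqP; rewrite eq_le pZ//=.
rewrite -ler_pdivlMl//.
by rewrite -{1}[x](scalerK (lt0r_neq0 t0)) pZ// invr_gt0.
Qed.

Lemma sublinear0 p : sublinear p -> p 0 = 0.
Proof.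
by move=> sp; have := sublinearZ 0 sp (ltr0n R 2); rewrite scaler0; lra.
Qed.

Lemma sublinear_oppr p x : sublinear p -> - p (- x) <= p x.
Proof. by move=> sp; have := sp.1 x (- x); rewrite subrr sublinear0//; lra. Qed.

(** The common part of the two constructions of smaller sublinear functionals
    below, the infimum of a chain and [sublinear_shift]. *)
Lemma inf_sublinear (G : set (V -> R)) (l : V -> R) : G !=set0 ->
  (forall g x, G g -> l x <= g x) ->
  (forall g h x y, G g -> G h -> exists2 k, G k & k (x + y) <= g x + h y) ->
  (forall g t x, G g -> 0 < t -> exists2 k, G k & k (t *: x) <= t * g x) ->
  exists2 q, sublinear q & (forall g x, G g -> q x <= g x).
Proof.
move=> [g0 Gg0] lG GD GZ; pose q x := inf [set g x | g in G].
have has_inf_G x : has_inf [set g x | g in G].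
  by split; [exists (g0 x), g0 | exists (l x) => _ [g Gg <-]; exact: lG].
have qG g x : G g -> q x <= g x.
  by move=> Gg; apply: ge_inf; [case: (has_inf_G x)|exists g].
have qlt x (e : R) : 0 < e -> exists2 g, G g & g x < q x + e.
  by move=> e0; have [_ [g Gg <-]] := inf_adherent e0 (has_inf_G x); exists g.
exists q => //; split=> [x y|t x t0]; apply/ler_addgt0Pr => e e0.
  have e20 : 0 < e / 2 by rewrite divr_gt0.
  have [g Gg gx] := qlt x _ e20; have [h Gh hy] := qlt y _ e20.
  have [k Gk kxy] := GD _ _ x y Gg Gh.
  by have := qG _ (x + y) Gk; lra.
have [g Gg gx] := qlt x _ (divr_gt0 e0 t0).
have [k Gk kx] := GZ _ _ x Gg t0.
apply: (le_trans (qG _ _ Gk)); apply: (le_trans kx).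
by rewrite -ler_pdivlMl// mulrDr mulKf ?lt0r_neq0// mulrC ltW// [t^-1 * e]mulrC mulrC.
Qed.

(** The functional [q x = inf_(t >= 0) (p (x + t y) - t p y)] is at most [p], and
    its bound at [t = 1] serves twice: it makes minimal sublinear functionals
    additive and, taken at [x = - y], forces every linear [f <= q] to satisfy
    [f y >= p y]. *)
Lemma sublinear_shift p y : sublinear p ->
  exists2 q, sublinear q & forall x, q x <= p x /\ q x <= p (x + y) - p y.
Proof.
move=> sp; pose g t x := p (x + t *: y) - t * p y.
have pty t : 0 <= t -> p (t *: y) = t * p y.
  rewrite le_eqVlt => /orP[/eqP<-|t0]; last exact: sublinearZ.
  by rewrite scale0r mul0r sublinear0.
have [||_ h x z [t t0 <-] [s s0 <-]|_ t x [s s0 <-] t0|q sq qg] :=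
    @inf_sublinear [set g t | t in [set t | 0 <= t]] (fun x => - p (- x)).
- by exists (g 0); exists 0 => //=.
- move=> _ x [t /= t0 <-]; rewrite /g.
  have := sp.1 (x + t *: y) (- x); rewrite addrC addKr pty//.
  lra.
- exists (g (t + s)); first by exists (t + s) => //=; rewrite addr_ge0.
  rewrite /g scalerDl addrACA mulrDl.
  by have := sp.1 (x + t *: y) (z + s *: y); lra.
- exists (g (t * s)); first by exists (t * s) => //=; rewrite mulr_ge0// ltW.
  by rewrite /g -scalerA -scalerDr sublinearZ// mulrBr mulrA.
- have qg0 x t : 0 <= t -> q x <= g t x by move=> t0; apply: qg; exists t.
  exists q => // x; split.
    by have := qg0 x 0 (lexx 0); rewrite /g scale0r addr0 mul0r subr0.
  by have := qg0 x 1 ler01; rewrite /g scale1r mul1r.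
Qed.

(** By Zorn's lemma; a chain is bounded below since [- p (- x) <= q x] for every
    sublinear [q <= p]. *)
Lemma minimal_sublinear p : sublinear p ->
  exists q, [/\ sublinear q, forall x, q x <= p x &
    forall r, sublinear r -> (forall x, r x <= q x) -> forall x, q x <= r x].
Proof.
move=> sp; pose T := {q | sublinear q /\ forall x, q x <= p x}.
pose ge (q r : T) := `[< forall x, sval r x <= sval q x >].
have [|q r s /asboolP qr /asboolP rs|A tA|[q [sq qp]] qmin] :=
    @ZL_preorder T (exist _ p (conj sp (fun x => lexx (p x)))) ge.
- by move=> q; apply/asboolP.
- by apply/asboolP => x; exact: le_trans (rs x) (qr x).
- have [A0|/set0P/negP/negPn/eqP A0] := pselect (A !=set0); last first.
    by exists (exist _ p (conj sp (fun x => lexx (p x)))) => s; rewrite A0.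
  have [|_ x [g Ag <-]|_ _ x y [g Ag <-] [h Ah <-]|_ t x [g Ag <-] t0|q sq qA]
      := @inf_sublinear [set sval g | g in A] (fun x => - p (- x)).
  + by case: A0 => g Ag; exists (sval g), g.
  + case: g Ag => g [sg gp] /= _; apply: le_trans (sublinear_oppr x sg).
    by rewrite lerN2.
  + have [/asboolP gh|/asboolP hg] := tA _ _ Ag Ah.
      exists (sval h); first by exists h.
      by apply: le_trans ((svalP h).1.1 _ _) _; rewrite lerD2r gh.
    exists (sval g); first by exists g.
    by apply: le_trans ((svalP g).1.1 _ _) _; rewrite lerD2l hg.
  + by exists (sval g); [exists g | exact: (svalP g).1.2].
  have qp x : q x <= p x.
    case: A0 => g Ag; apply: le_trans ((svalP g).2 x).
    by apply: qA; exists g.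
  exists (exist _ q (conj sq qp)) => s As; apply/asboolP => x /=.
  by apply: qA; exists s.
exists q; split => // r sr rq x.
have rp y : r y <= p y by exact: le_trans (rq y) (qp y).
have /asboolP := qmin (exist _ r (conj sr rp)) (introT (asboolP _) rq).
exact.
Qed.

(** A minimal [q] is equal to each of its shifts, so that
    [q x <= q (x + y) - q y]. *)
Lemma minimal_sublinear_linear q : sublinear q ->
  (forall r, sublinear r -> (forall x, r x <= q x) -> forall x, q x <= r x) ->
  linear (q : V -> R^o).
Proof.
move=> sq qmin.
have qD x y : q (x + y) = q x + q y.
  have [r sr rq] := sublinear_shift y sq.
  have := qmin r sr (fun x => (rq x).1) x.
  have := (rq x).2; have := sq.1 x y; lra.
have qN x : q (- x) = - q x.
  by have := qD x (- x); rewrite subrr sublinear0//; lra.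
move=> t x y; rewrite qD; congr (_ + _).
have [t0|t0|->] := ltgtP t 0.
- rewrite -[t]opprK scaleNr qN sublinearZ ?oppr_gt0//.
  by rewrite -mulNr.
- exact: sublinearZ.
- by rewrite !scale0r sublinear0.
Qed.

(** Any minimal sublinear functional below the shift of [p] by [w] will do. *)
Theorem hahn_banach p w : sublinear p ->
  exists f : {linear V -> R^o}, (forall x, f x <= p x) /\ f w = p w.
Proof.
move=> sp; have [r sr rp] := sublinear_shift w sp.
have [q [sq qr qmin]] := minimal_sublinear sr.
have lq := minimal_sublinear_linear sq qmin.
pose f : {linear V -> R^o} := HB.pack (q : V -> R^o)
  (GRing.isLinear.Build R V R^o *:%R (q : V -> R^o) lq).
exists f; have fp x : f x <= p x by exact: le_trans (qr x) (rp x).1.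
split=> //; apply/eqP; rewrite eq_le fp /=.
have : f (- w) <= p (- w + w) - p w by exact: le_trans (qr _) (rp _).2.
by rewrite addNr sublinear0// linearN sub0r lerN2.
Qed.
End HahnBanach.
(** * Compactness in real normed spaces *)

Lemma increasing_seq_cvgy (f : nat -> nat) : increasing_seq f -> f @ \oo --> \oo.
Proof.
move=> fi; apply/cvgnyPge => A; near=> n.
have nf k : (k <= f k)%N.
  elim: k => // k ih; apply: leq_ltn_trans ih _.
  by move/increasing_seqP : fi => /(_ k); rewrite ltEnat.
by apply: leq_trans (nf n); near: n; exact: nbhs_infty_ge.
Unshelve. all: by end_near. Qed.

Lemma increasing_seq_comp (f g : nat -> nat) :
  increasing_seq f -> increasing_seq g -> increasing_seq (f \o g).
Proof. move=> fi gi m n; exact: etrans (fi (g m) (g n)) (gi m n). Qed.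

Lemma cvg_subsequence (T : topologicalType) (u : nat -> T) (l : T) f :
  increasing_seq f -> u @ \oo --> l -> (u \o f) @ \oo --> l.
Proof. by move=> /increasing_seq_cvgy fy ul; exact: cvg_comp fy ul. Qed.

Section BoundedlyCompact.
Variables (R : realType) (V : normedModType R).

Definition boundedly_compact (M : set V) :=
  forall (u : nat -> V) (C : R), (forall n, M (u n)) -> (forall n, `|u n| <= C) ->
  exists2 f : nat -> nat, increasing_seq f &
    exists2 x, M x & (u \o f) @ \oo --> x.

(** Otherwise [v] is a limit of elements of [M]; these are bounded, so that [v]
    is in [M]. *)
Lemma distance_to_boundedly_compact (M : set V) v :
  boundedly_compact M -> ~ M v ->
  exists2 c : R, 0 < c & forall w, M w -> c <= `|v - w|.
Proof.
move=> cM Mv; apply: contrapT => noc.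
have /choice[w wP] n : exists w, M w /\ `|v - w| < n.+1%:R^-1.
  apply: contrapT => nw; apply: noc; exists n.+1%:R^-1; first by rewrite invr_gt0.
  by move=> w Mw; rewrite leNgt; apply/negP => vw; apply: nw; exists w.
have [|n|f fi [x Mx wx]] := cM w (`|v| + 1); first by move=> n; exact: (wP n).1.
  rewrite -[w n](subrK v) addrC (le_trans (ler_normD _ _))// lerD2l distrC.
  by rewrite (le_trans (ltW (wP n).2))// invf_le1 ?ler1n.
apply: Mv; suff -> : v = x by [].
have vw : w @ \oo --> v.
  apply/cvgrPdist_lt => e e0; near=> n.
  apply: lt_trans (wP n).2 _.
  by near: n; exact: (near_infty_natSinv_lt (PosNum e0)).
by apply: (cvg_unique _ (cvg_subsequence fi vw) wx).
Unshelve. all: by end_near. Qed.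

(** If [v] is not in [M], its positive distance to [M] bounds the coefficients
    [a] of a bounded sequence of vectors [w + a v]: one extracts a convergent
    subsequence of the coefficients, and then one of the components in [M]. *)
Lemma boundedly_compact_add_line (M : set V) v :
  (forall a x y, M x -> M y -> M (a *: x + y)) -> boundedly_compact M ->
  boundedly_compact [set z | exists a : R, M (z - a *: v)].
Proof.
move=> linM cM u C uM uC.
have M0 : M 0.
  have [a] := uM 0.
  by move=> /[dup] Ma /(linM (-1) _ _ Ma); rewrite scaleN1r addNr.
have MZ a x : M x -> M (a *: x) by move=> Mx; rewrite -[_ *: _]addr0; exact: linM.
have [Mv|Mv] := pselect (M v).
  have uM' n : M (u n).
    by have [a Mua] := uM n; rewrite -(subrK (a *: v) (u n)) addrC; exact: linM.
  have [f fi [x Mx ux]] := cM u C uM' uC.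
  by exists f => //; exists x => //; exists 0; rewrite scale0r subr0.
have [c c0 cM'] := distance_to_boundedly_compact cM Mv.
have /choice[a aP] n : exists a, M (u n - a *: v) := uM n.
have aC n : `|a n| <= C / c.
  have [->|an0] := eqVneq (a n) 0.
    by rewrite normr0 divr_ge0 ?(ltW c0)// (le_trans _ (uC 0%N)).
  rewrite ler_pdivlMr//; apply: le_trans (uC n).
  (* This displays [u n] as [a n] times the difference of [v] and an element of [M]. *)
  have -> : u n = a n *: (v - - (a n)^-1 *: (u n - a n *: v)).
    rewrite scaleNr opprK scalerDr scalerA divff// scale1r.
    by rewrite addrC subrK.
  by rewrite normrZ ler_wpM2l//; apply: cM'; exact: MZ.
have [|f fi /cvg_ex[a0 aa0]] := @bolzano_weierstrass _ a.
  exists (C / c); split; first exact: num_real.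
  by move=> x Cx n _ /=; apply: le_trans (aC n) (ltW Cx).
pose w n := u (f n) - a (f n) *: v.
have [|n|g gi [x Mx wx]] := cM w (C + C / c * `|v|); first by move=> n; exact: aP.
  rewrite (le_trans (ler_normB _ _))// lerD// normrZ.
  by rewrite ler_wpM2r.
exists (f \o g); first exact: increasing_seq_comp.
exists (x + a0 *: v); first by exists a0; rewrite addrK.
have -> : u \o (f \o g) = (w \o g) + (fun n => (a \o f \o g) n *: v).
  by apply/funext => n; rewrite /w/= fctE /= subrK.
apply: cvgD => //; apply: cvgZl => //.
exact: (cvg_subsequence gi aa0).
Qed.

Lemma finite_dimensional_boundedly_compact (M : set V) :
  finite_dimensional M -> boundedly_compact M.
Proof.
move=> [d [e ->]]; elim: d e => [e u C uM _|d ih e].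
  exists id => //; exists 0; first by exists (fun=> 0); rewrite big_ord0.
  rewrite (_ : _ \o _ = fun=> 0); first exact: cvg_cst.
  by apply/funext => n /=; have [a ->] := uM n; rewrite big_ord0.
pose e' (i : 'I_d) := e (widen_ord (leqnSn d) i).
pose M' := [set z | exists a : 'I_d -> R, z = \sum_(i < d) a i *: e' i].
have -> : [set z | exists a : 'I_d.+1 -> R, z = \sum_(i < d.+1) a i *: e i] =
    [set z | exists a : R, M' (z - a *: e ord_max)].
  apply/seteqP; split => [z [a ->]|z [t [a az]]].
    exists (a ord_max), (fun i => a (widen_ord (leqnSn d) i)).
    by rewrite big_ord_recr /= addrK.
  exists (fun i => if insub (val i) is Some k then a k else t).
  rewrite big_ord_recr /= insubF ?ltnn// -[LHS](subrK (t *: e ord_max)) az.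
  congr (_ + _); apply: eq_bigr => i _; rewrite insubT//= => ?.
  by congr (a _ *: _); exact: val_inj.
apply: boundedly_compact_add_line; last exact: ih.
move=> t x y [a ->] [c ->]; exists (fun i => t * a i + c i).
rewrite scaler_sumr -big_split /=; apply: eq_bigr => i _.
by rewrite scalerDl scalerA.
Qed.
End BoundedlyCompact.

Section MaximizingCompact.
Variables (R : realType) (V : normedModType R).

(** The compactness that both classes of spaces [Y] share: finite dimensional
    subspaces have it, and so do uniformly convex Banach spaces. *)
Definition maximizing_compact (N : set V) :=
  forall (f : {linear V -> R^o}) (u : nat -> V), (forall v, f v <= `|v|) ->
  (forall n, N (u n)) -> (forall n, `|u n| = 1) -> (f \o u) @ \oo --> (1 : R) ->
  exists2 g : nat -> nat, increasing_seq g & cvgn (u \o g).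

Lemma boundedly_compact_maximizing (N : set V) :
  boundedly_compact N -> maximizing_compact N.
Proof.
move=> cN f u _ uN u1 _; have [|g gi [x _ ux]] := cN u 1 uN.
  by move=> n; rewrite u1.
by exists g => //; apply/cvg_ex; exists x.
Qed.
End MaximizingCompact.

(** If [`|u m - u n|] is not small, the midpoint of [u m] and [u n] has norm at
    most [1 - d], although [f] is larger than [1 - d] at both ends. *)
Lemma uniformly_convex_maximizing (R : realType) (V : completeNormedModType R) :
  uniformly_convex V -> maximizing_compact [set: V].
Proof.
move=> ucV f u fle _ u1 fu; exists id => //.
apply/cauchy_cvgP/cauchy_ballP => e e0.
have [|d d0 ud] := ucV (Num.min e 2).
  by rewrite lt_min e0 ltr0n ge_min lexx orbT.
have : \forall n \near \oo, 1 - d < f (u n).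
  by move/cvgr_gt : fu => /(_ (1 - d)); apply; rewrite gtrBl.
move=> [N _ Nd]; pose A := [set u n | n in [set n | (N <= n)%N]].
exists (A, A); first by split; exists N => // n Nn; exists n.
move=> [_ _] [[m /Nd mN <-] [n /Nd nN <-]]; rewrite -ball_normE /=.
have : `|u m - u n| < Num.min e 2.
  rewrite ltNge; apply/negP => /(ud _ _ (u1 m) (u1 n)).
  have := fle (2^-1 *: (u m + u n)); rewrite linearZ linearD /=.
  by move: mN nN; rewrite /GRing.scale /=; lra.
by rewrite lt_min => /andP[].
Qed.


(** * Exact maximisers of a functional on elementary tensors *)

Section ExactMaximizers.
Variables (R : realType) (X Y Z : normedModType R).
Variables (b : {bilinear X -> Y -> Z}) (f : {linear Z -> R^o}).
Hypothesis bM : forall x y, `|b x y| <= `|x| * `|y|.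
Hypothesis fM : forall z, f z <= `|z|.

Lemma bilinear_dist x y x' y' : 
  `|b x y - b x' y'| <= `|x - x'| * `|y| + `|x'| * `|y - y'|.
Proof.
have -> : b x y - b x' y' = b (x - x') y + b x' (y - y').
  by rewrite linearBl linearBr addrA subrK.
by rewrite (le_trans (ler_normD _ _))// lerD.
Qed.

Variables (M : set X) (N : set Y).
Hypotheses (MZ : forall a x, M x -> M (a *: x)) (NZ : forall a y, N y -> N (a *: y)).
Hypotheses (cM : boundedly_compact M) (cN : maximizing_compact N).

(** Otherwise there are maximising unit vectors [x n] and [y n] far from all
    exact maximisers. Along a subsequence [x n --> x0], so [y n] maximises
    [f (b x0 _)] and has a limit [y0] along a further subsequence; but then
    [(x0, y0)] is an exact maximiser. *)
Lemma near_exact_unit_maximizer (e : R) : 0 < e ->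
  exists2 eta : R, 0 < eta & forall x y, M x -> N y -> `|x| = 1 -> `|y| = 1 ->
    1 - eta < f (b x y) ->
    exists x' y', [/\ f (b x' y') = 1, `|x'| = 1, `|y'| = 1,
                      `|x - x'| < e & `|y - y'| < e].
Proof.
move=> e0.
(* [f] with its values in [R] itself instead of the module [R^o]. *)
pose F : Z -> R := f; have FM : forall z, F z <= `|z| := fM.
have FB u v : F (u - v) = F u - F v by exact: (linearB f).
apply: contrapT => noeta.
have /choice[u uP] n : exists p : X * Y, [/\ M p.1, N p.2, `|p.1| = 1, `|p.2| = 1
    & 1 - n.+1%:R^-1 < F (b p.1 p.2)] /\
    ~ exists x' y', [/\ F (b x' y') = 1, `|x'| = 1, `|y'| = 1,
                      `|p.1 - x'| < e & `|p.2 - y'| < e].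
  apply: contrapT => np; apply: noeta; exists n.+1%:R^-1; first by rewrite invr_gt0.
  move=> x y Mx Ny x1 y1 fxy; apply: contrapT => nxy; apply: np.
  by exists (x, y); split.
pose x n := (u n).1; pose y n := (u n).2.
have uP1 n : [/\ M (x n), N (y n), `|x n| = 1, `|y n| = 1 &
    1 - n.+1%:R^-1 < F (b (x n) (y n))] := (uP n).1.
have [n|n|g gi [x0 _ xx0]] := cM (u := x) (C := 1); first by case: (uP1 n).
  by case: (uP1 n) => _ _ ->.
have x01 : `|x0| = 1.
  apply: cvg_unique (cvg_norm xx0) _ => //.
  rewrite (_ : (fun _ => _) = fun=> 1); first exact: cvg_cst.
  by apply/funext => n /=; case: (uP1 (g n)).
have fx0 : (fun n => F (b x0 (y (g n)))) @ \oo --> (1 : R).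
  apply/cvgrPdist_lt => d d0; have d20 : 0 < d / 2 by rewrite divr_gt0.
  near=> n; have [_ _ _ y1 fxy] := uP1 (g n).
  have le1 : F (b x0 (y (g n))) <= 1.
    by rewrite (le_trans (FM _))// (le_trans (bM _ _))// x01 y1 mulr1.
  rewrite ger0_norm ?subr_ge0//.
  have fx : F (b (x (g n)) (y (g n)) - b x0 (y (g n))) <= `|x0 - x (g n)|.
    rewrite (le_trans (FM _))// (le_trans (bilinear_dist _ _ _ _))// distrC.
    by rewrite y1 subrr normr0 mulr0 mulr1 addr0.
  have xd : `|x0 - x (g n)| < d / 2.
    by near: n; move/cvgrPdist_lt : xx0; apply; rewrite divr_gt0.
  have gd : (g n).+1%:R^-1 < d / 2.
    by near: n; exact: (increasing_seq_cvgy gi (near_infty_natSinv_lt (PosNum d20))).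
  move: fx; rewrite FB => fx.
  have arith (p q r t c : R) : q - p <= r -> 1 - t < q -> r < c / 2 -> t < c / 2 ->
    1 - p < c by lra.
  exact: arith fx fxy xd gd.
have [|n|n|h hi /cvg_ex[y0 yy0]] := cN (f := f \o b x0) (u := y \o g) _ _ _ fx0.
- by move=> v; rewrite /= (le_trans (FM _))// (le_trans (bM _ _))// x01 mul1r.
- by case: (uP1 (g n)).
- by case: (uP1 (g n)).
have y01 : `|y0| = 1.
  apply: cvg_unique (cvg_norm yy0) _ => //.
  rewrite (_ : (fun _ => _) = fun=> 1); first exact: cvg_cst.
  by apply/funext => n /=; case: (uP1 (g (h n))).
have fxy0 : F (b x0 y0) = 1.
  apply/eqP; rewrite eq_le; apply/andP; split.
    by rewrite (le_trans (FM _))// (le_trans (bM _ _))// x01 y01 mulr1.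
  apply/ler_addgt0Pr => d d0.
  near \oo => n.
  have : 1 - d / 2 < F (b x0 (y (g (h n)))).
    near: n; move/cvgr_gt : (cvg_subsequence hi fx0); apply.
    by rewrite gtrBl divr_gt0.
  have : F (b x0 (y (g (h n))) - b x0 y0) <= `|y0 - y (g (h n))|.
    rewrite (le_trans (FM _))// (le_trans (bilinear_dist _ _ _ _))//.
    by rewrite subrr normr0 mul0r add0r x01 mul1r distrC.
  have : `|y0 - y (g (h n))| < d / 2.
    by near: n; move/cvgrPdist_lt : yy0; apply; rewrite divr_gt0.
  rewrite FB; lra.
near \oo => n; apply: (uP (g (h n))).2; exists x0, y0; split => //.
  rewrite distrC; near: n.
  by move/cvgrPdist_lt : (cvg_subsequence hi xx0); apply.
by rewrite distrC; near: n; move/cvgrPdist_lt : yy0; apply.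
Unshelve. all: by end_near. Qed.

(** The previous lemma for vectors of any norm, by homogeneity; the strict
    inequality excludes [x = 0] and [y = 0]. *)
Lemma near_exact_maximizer (e : R) : 0 < e ->
  exists2 eta : R, 0 < eta & forall x y, M x -> N y ->
    (1 - eta) * (`|x| * `|y|) < f (b x y) ->
    exists p : X * Y, f (b p.1 p.2) = `|p.1| * `|p.2| /\
      `|b x y - b p.1 p.2| <= e * (`|x| * `|y|).
Proof.
move=> e0; have e20 : 0 < e / 2 by rewrite divr_gt0.
have [eta eta0 etaP] := near_exact_unit_maximizer e20.
exists eta => // x y Mx Ny fxy.
have xy0 : 0 < `|x| * `|y|.
  rewrite lt_neqAle mulr_ge0// andbT eq_sym; apply/eqP => xy0.
  have : f (b x y) <= `|x| * `|y| by exact: le_trans (fM _) (bM _ _).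
  by move: fxy; rewrite xy0 mulr0 => fxy /(lt_le_trans fxy); rewrite ltxx.
have x0 : 0 < `|x|.
  by rewrite lt_neqAle normr_ge0 andbT; apply: contraTN xy0 => /eqP<-; rewrite mul0r ltxx.
have y0 : 0 < `|y|.
  by rewrite lt_neqAle normr_ge0 andbT; apply: contraTN xy0 => /eqP<-; rewrite mulr0 ltxx.
have unit_normalized (V : normedModType R) (v : V) : 0 < `|v| -> `| `|v|^-1 *: v| = 1.
  by move=> v0; rewrite normrZ normfV normr_id mulVf// lt0r_neq0.
have bZ a c u v : b (a *: u) (c *: v) = (a * c) *: b u v.
  by rewrite linearZl_LR linearZr_LR scalerA.
have fZ a c u v : f (b (a *: u) (c *: v)) = a * c * f (b u v) :> R.
  by rewrite bZ linearZ.
pose x1 := `|x|^-1 *: x; pose y1 := `|y|^-1 *: y.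
have [|||||x' [y' [fxy' x'1 y'1 xx' yy']]] := etaP x1 y1.
- exact: MZ.
- exact: NZ.
- exact: unit_normalized.
- exact: unit_normalized.
- by rewrite fZ -invfM ltr_pdivlMl// mulrC.
exists (`|x| *: x', `|y| *: y') => /=; split.
  by rewrite fZ fxy' mulr1 !normrZ !normr_id x'1 y'1 !mulr1.
have xE : x = `|x| *: x1 by rewrite /x1 scalerA divff ?scale1r// lt0r_neq0.
have yE : y = `|y| *: y1 by rewrite /y1 scalerA divff ?scale1r// lt0r_neq0.
rewrite {1}xE {1}yE (bZ _ _ x1 y1) (bZ _ _ x' y') -scalerBr normrZ.
rewrite ger0_norm ?mulr_ge0// mulrC ler_wpM2r ?mulr_ge0//.
rewrite (le_trans (bilinear_dist _ _ _ _))// unit_normalized// x'1.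
by rewrite mulr1 mul1r [leRHS]splitr lerD// ltW.
Qed.

End ExactMaximizers.

(** * Perturbation to a norm attaining sum *)

Section NormAttainingSums.
Variables (R : realType) (X Y Z : normedModType R) (b : {bilinear X -> Y -> Z}).
Hypothesis bM : forall x y, `|b x y| <= `|x| * `|y|.
Variables (M : set X) (N : set Y).
Hypotheses (MZ : forall a x, M x -> M (a *: x)) (NZ : forall a y, N y -> N (a *: y)).
Hypotheses (cM : boundedly_compact M) (cN : maximizing_compact N).

(** Let [f] be a norming functional of [w]. In a representation of [w] of cost
    close to [`|w|], the terms at which [f] is not almost maximal have a small
    total cost; drop them, and replace the other ones by exact maximisers. *)
Lemma near_norm_attaining_sum (w : Z) :
  (forall d : R, 0 < d -> exists s : seq (X * Y),
    [/\ forall p, p \in s -> M p.1 /\ N p.2, w = \sum_(p <- s) b p.1 p.2 &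
        \sum_(p <- s) `|p.1| * `|p.2| < `|w| + d]) ->
  forall e : R, 0 < e -> exists s : seq (X * Y),
    `|w - \sum_(p <- s) b p.1 p.2| < e /\
    `|\sum_(p <- s) b p.1 p.2| = \sum_(p <- s) `|p.1| * `|p.2|.
Proof.
move=> ws e e0.
have sublinear_norm : sublinear (fun z : Z => `|z| : R).
  split=> [x y|t x t0]; first exact: ler_normD.
  by rewrite normrZ gtr0_norm.
have [f [fM fw]] := hahn_banach w sublinear_norm.
(* The terms dropped contribute at most [e / 3], as their cost times [eta] is at
   most [eta * (e / 3)]. The terms replaced contribute at most [eps] times their
   cost, which is at most [`|w| + 1]. *)
pose eps := e / 3 / (`|w| + 1).
have w10 : 0 < `|w| + 1 by rewrite ltr_wpDl.
have e30 : 0 < e / 3 by rewrite divr_gt0.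
have eps0 : 0 < eps by rewrite divr_gt0.
have [eta eta0 etaP] := near_exact_maximizer bM fM MZ NZ cM cN eps0.
have [|s [sMN wE sw]] := ws (Num.min 1 (eta * (e / 3))).
  by rewrite lt_min ltr01 mulr_gt0.
pose cost (p : X * Y) : R := `|p.1| * `|p.2|.
pose F (z : Z) : R := f z.
pose good p := (1 - eta) * cost p < F (b p.1 p.2).
have cost_ge0 p : 0 <= cost p by rewrite mulr_ge0.
have /choice[g gP] (p : X * Y) : exists q : X * Y, M p.1 -> N p.2 -> good p ->
    F (b q.1 q.2) = cost q /\ `|b p.1 p.2 - b q.1 q.2| <= eps * cost p.
  have [[Mp [Np gp]]|np] := pselect (M p.1 /\ N p.2 /\ good p).
    by have [q ?] := etaP p.1 p.2 Mp Np gp; exists q.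
  by exists p => Mp Np gp; case: np.
have Fsum (I : eqType) (r : seq I) (P : pred I) (h : I -> Z) :
    F (\sum_(i <- r | P i) h i) = \sum_(i <- r | P i) F (h i).
  exact: (linear_sum f).
exists [seq g p | p <- s & good p].
rewrite !big_map !big_filter.
have costF : \sum_(p <- s | good p) cost (g p) =
    F (\sum_(p <- s | good p) b (g p).1 (g p).2).
  rewrite Fsum big_seq_cond [RHS]big_seq_cond; apply: eq_bigr => p /andP[ps gp].
  by have [Mp Np] := sMN p ps; have [] := gP p Mp Np gp.
split; last first.
  apply/eqP; rewrite eq_le; apply/andP; split.
    by apply: le_trans (ler_norm_sum _ _ _) _; apply: ler_sum => p _; exact: bM.
  by rewrite -/(cost _) costF; exact: fM.
have bad : eta * \sum_(p <- s | ~~ good p) cost p < eta * (e / 3).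
  have : \sum_(p <- s) (cost p - F (b p.1 p.2)) < eta * (e / 3).
    rewrite sumrB -Fsum -wE /F fw ltrBlDl.
    by apply: lt_le_trans sw _; rewrite lerD2l ge_min lexx orbT.
  apply: le_lt_trans; rewrite mulr_sumr [leRHS](bigID good) /=.
  rewrite -[leLHS]add0r lerD//.
    apply: sumr_ge0 => p _; rewrite subr_ge0.
    exact: le_trans (fM _) (bM _ _).
  by apply: ler_sum => p; rewrite /good -leNgt mulrBl mul1r lerBrDl -lerBrDr.
rewrite ltr_pM2l// in bad.
rewrite wE (bigID good) /= addrAC -sumrB.
apply: le_lt_trans (ler_normD _ _) _.
apply: (@le_lt_trans _ _ (e / 3 + e / 3)); last by lra.
apply: lerD; last first.
  apply: le_trans (ltW bad); apply: le_trans (ler_norm_sum _ _ _) _.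
  by apply: ler_sum => p _; exact: bM.
have -> : e / 3 = eps * (`|w| + 1) by rewrite /eps mulfVK// lt0r_neq0.
apply: (@le_trans _ _ (eps * \sum_(p <- s | good p) cost p)).
  apply: le_trans (ler_norm_sum _ _ _) _; rewrite mulr_sumr.
  rewrite big_seq_cond [leRHS]big_seq_cond; apply: ler_sum => p /andP[ps gp].
  by have [Mp Np] := sMN p ps; have [] := gP p Mp Np gp.
rewrite ler_wpM2l ?(ltW eps0)//.
apply: (@le_trans _ _ (\sum_(p <- s) cost p)).
  by rewrite [leRHS](bigID good) /= lerDl sumr_ge0.
by apply: le_trans (ltW sw) _; rewrite lerD2l ge_min lexx.
Qed.
End NormAttainingSums.

(** * Algebraic tensor products *)

Section Tensors.
Variables (K : numFieldType) (X Y : lmodType K).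

Lemma tensor_linearl (y : Y) : linear (fun x : X => x ⊗ y).
Proof.
move=> a x x'; apply: val_inj; rewrite linearP; apply/funext => A.
exact: (linearPl A).
Qed.

Lemma tensor_linearr (x : X) : linear (fun y : Y => x ⊗ y).
Proof.
move=> a y y'; apply: val_inj; rewrite linearP; apply/funext => A.
exact: (linearPr A).
Qed.

Lemma tensorBl (x x' : X) (y : Y) : (x - x') ⊗ y = x ⊗ y - x' ⊗ y.
Proof.
by rewrite [x - x']addrC -scaleN1r tensor_linearl scaleN1r addrC.
Qed.

Lemma tensorBr (x : X) (y y' : Y) : x ⊗ (y - y') = x ⊗ y - x ⊗ y'.
Proof.
by rewrite [y - y']addrC -scaleN1r tensor_linearr scaleN1r addrC.
Qed.

Lemma tensor_sumE (s : seq (X * Y)) A :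
  tensor_val (\sum_(p <- s) p.1 ⊗ p.2) A = \sum_(p <- s) A p.1 p.2.
Proof.
elim: s => [|p s ih]; first by rewrite !big_nil.
by rewrite !big_cons -ih.
Qed.

Lemma tensor_sum (u : tensor X Y) : exists s : seq (X * Y), u = \sum_(p <- s) p.1 ⊗ p.2.
Proof.
case: u => v /[dup] /asboolP[s vE] vP; exists s; apply: val_inj => /=.
apply/funext => A; rewrite tensor_sumE vE.
by rewrite fct_sumE.
Qed.

(** The map [P ⊗ Q] is well defined: the value of [\sum P x ⊗ Q y] at a bilinear
    form [A] is the value of [\sum x ⊗ y] at the form [A (P _) (Q _)]. *)
Lemma tensor_map (P : {linear X -> X}) (Q : {linear Y -> Y}) (s t : seq (X * Y)) :
  \sum_(p <- s) p.1 ⊗ p.2 = \sum_(p <- t) p.1 ⊗ p.2 ->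
  \sum_(p <- s) P p.1 ⊗ Q p.2 = \sum_(p <- t) P p.1 ⊗ Q p.2.
Proof.
move=> st; have sumE r : \sum_(p <- r) P p.1 ⊗ Q p.2 =
    \sum_(p <- [seq (P p.1, Q p.2) | p <- r]) p.1 ⊗ p.2 by rewrite big_map.
rewrite !sumE; apply: val_inj; apply/funext => A /=.
rewrite !tensor_sumE !big_map /=.
have bA : @bilinear_for K X Y K^o *:%R *:%R (fun x y => A (P x) (Q y)).
  split=> [y|x] a v w; first by rewrite linearP linearPl.
  by rewrite linearP linearPr.
pose APQ : {bilinear X -> Y -> K^o} := HB.pack (fun x y => A (P x) (Q y) : K^o)
  (bilinear_isBilinear.Build K X Y K^o _ _ _ bA).
by have := congr1 (fun u : tensor X Y => tensor_val u APQ) st; rewrite !tensor_sumE.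
Qed.
End Tensors.

(** * The metric π-property *)

Section MetricPi.
Variables (K : numFieldType) (V : normedModType K).

(** The property extends from unit vectors to all vectors by scaling. A
    projection of norm at most one onto a subspace which comes close to [v] at distance
    [d] moves [v] by at most [2 d]. *)
Lemma metric_pi_projection : metric_pi_property V ->
  forall (s : seq V) (e : K), 0 < e -> exists P : {linear V -> V},
    [/\ forall v, P (P v) = P v, forall v, `|P v| <= `|v|,
        finite_dimensional (range P) & forall v, v \in s -> `|v - P v| < e].
Proof.
move=> piV s e e0; pose C := 1 + \sum_(v <- s) `|v|.
have C0 : 0 < C by rewrite ltr_pwDl// sumr_ge0.
have d0 : 0 < e / C / 2 by rewrite !divr_gt0.
(* The vector [0], which cannot be normalised, is fixed by any projection. *)
pose t := [seq v <- s | v != 0].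
pose z (i : 'I_(size t)) := `|tnth (in_tuple t) i|^-1 *: tnth (in_tuple t) i.
have [i|M [fM [P [PP Pc PM]] zM]] := piV _ _ z d0.
  have : tnth (in_tuple t) i \in t by exact: mem_tnth.
  rewrite mem_filter => /andP[ti0 _].
  by rewrite /unit_sphere /= normrZ normfV normr_id mulVf// normr_eq0.
exists P; rewrite PM; split => // v vs.
have [->|v0] := eqVneq v 0; first by rewrite linear0 subrr normr0.
have : v \in t by rewrite mem_filter v0.
move=> /(tnthP (in_tuple t))[i vi]; have [z' Mz' zz'] := zM i.
have v0' : 0 < `|v| by rewrite normr_gt0.
have Pz' : P z' = z' by move: Mz'; rewrite -PM => -[y _ <-].
have : v = `|v| *: z i by rewrite /z -vi scalerA divff ?scale1r// lt0r_neq0.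
move: (z i) zz' => u uz' vu.
have -> : v - P v = `|v| *: ((u - z') + P (z' - u)).
  by rewrite {1 2}vu linearZ -scalerBr (linearB P) Pz' addrA subrK.
rewrite normrZ normr_id.
apply: (@le_lt_trans _ _ (`|v| * (`|u - z'| + `|u - z'|))).
  rewrite ler_pM2l// (le_trans (ler_normD _ _))// lerD2l.
  by rewrite (le_trans (Pc _))// distrC.
apply: (@lt_le_trans _ _ (`|v| * (e / C))).
  by rewrite ltr_pM2l// [ltRHS]splitr ltrD.
rewrite mulrCA ger_pMr// ler_pdivrMr// mul1r /C (big_rem v vs)/=.
by rewrite addrCA lerDl addr_ge0// sumr_ge0.
Qed.
End MetricPi.

(** * Geometric properties under restriction of scalars *)

Section RealifiedGeometry.
Variables (R : realType) (K : numFieldType) (S : real_scalars R K).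
Variable V : normedModType K.

(** The vectors [e k] and [generator S *: e k] span [M] over the reals. *)
Lemma realified_finite_dimensional (M : set V) :
  finite_dimensional M -> finite_dimensional (M : set (realified S V)).
Proof.
move=> [d [e ->]]; exists (d + d)%N.
exists (fun i : 'I_(d + d) => match fintype.split i with
  | inl k => e k : realified S V | inr k => generator S *: e k : V end).
apply/seteqP; split=> z [a ->].
  have /choice[c cP] i : exists p : R * R, a i = emb S p.1 + emb S p.2 * generator S.
    by have [r [t ->]] := scalar_decomposition S (a i); exists (r, t).
  exists (fun i : 'I_(d + d) =>
    match fintype.split i with inl k => (c k).1 | inr k => (c k).2 end).
  rewrite big_split_ord /= -big_split /=; apply: eq_bigr => i _.
  rewrite -[lshift _ _]/(unsplit (inl i)) -[rshift _ _]/(unsplit (inr i)).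
  by rewrite !unsplitK !emb_scale cP scalerDl scalerA.
exists (fun k => emb S (a (lshift d k)) + emb S (a (rshift d k)) * generator S).
rewrite big_split_ord /= -big_split /=; apply: eq_bigr => i _.
rewrite -[lshift _ _]/(unsplit (inl i)) -[rshift _ _]/(unsplit (inr i)).
by rewrite !unsplitK !emb_scale scalerDl scalerA.
Qed.

Lemma realified_uniformly_convex :
  uniformly_convex V -> uniformly_convex (realified S V).
Proof.
move=> ucV e /andP[e0 e2].
have sphere (v : realified S V) : unit_sphere v -> unit_sphere (v : V).
  by rewrite /unit_sphere /= => v1; rewrite -emb_norm v1 rmorph1.
have [|d d0 dP] := ucV (emb S e).
  by rewrite -(rmorph0 (emb S)) ltr_emb e0 -(rmorph_nat (emb S) 2) ler_emb.
exists (re S d); first exact: re_gt0.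
move=> x y /sphere x1 /sphere y1; rewrite -(ler_emb S) emb_norm => /(dP _ _ x1 y1).
rewrite -(ler_emb S) emb_norm emb_scale fmorphV rmorph_nat rmorphB rmorph1.
by rewrite reK// ltW.
Qed.
End RealifiedGeometry.

(** * Density of the norm attaining tensors *)

Section NormAttaining.
Variables (K : numFieldType) (X Y Z : normedModType K) (j : tensor X Y -> Z).
Hypothesis hZ : is_projective_tensor_product j.

HB.instance Definition _ := GRing.isLinear.Build K (tensor X Y) Z *:%R j
  (projective_linear hZ).

Lemma projective_sum (I : Type) (s : seq I) (u : I -> tensor X Y) :
  j (\sum_(i <- s) u i) = \sum_(i <- s) j (u i).
Proof. exact: linear_sum. Qed.

Lemma projective_le x y : `|j (x ⊗ y)| <= `|x| * `|y|.
Proof.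
apply: (projective_norm hZ (x ⊗ y)).1.
by exists [:: (x, y)]; rewrite big_seq1.
Qed.

Lemma projective_cost_lt u d : 0 < d -> exists s : seq (X * Y),
  u = \sum_(p <- s) p.1 ⊗ p.2 /\ \sum_(p <- s) `|p.1| * `|p.2| < `|j u| + d.
Proof.
move=> d0; apply: contrapT => nos.
have : `|j u| + d <= `|j u|.
  apply: (projective_norm hZ u).2 => _ [s us ->].
  rewrite real_leNgt.
  - by apply/negP => su; apply: nos; exists s.
  - by rewrite ger0_real// addr_ge0// ltW.
  - by rewrite ger0_real// sumr_ge0// => p _; rewrite mulr_ge0.
by rewrite gerDl => /(lt_le_trans d0); rewrite ltxx.
Qed.

Lemma series_nth_cvg (T : Type) (V : normedModType K) (F : T -> V) d (s : seq T) :
  F d = 0 -> series (fun n => F (nth d s n)) @ \oo --> \sum_(p <- s) F p.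
Proof.
move=> Fd; apply: cvg_near_cst; near=> n.
have sn : (size s <= n)%N by near: n; exact: nbhs_infty_ge.
rewrite /series /= (big_cat_nat (n := size s))//= [X in _ + X]big_nat_cond.
rewrite [X in _ + X]big1 ?addr0 -?(big_nth _ xpredT)//.
by move=> i /andP[/andP[si _] _]; rewrite nth_default.
Unshelve. all: by end_near. Qed.

(** A finite representation is made into a series by adding zero terms. *)
Lemma norm_attaining_sum (s : seq (X * Y)) :
  `|\sum_(p <- s) j (p.1 ⊗ p.2)| = \sum_(p <- s) `|p.1| * `|p.2| ->
  norm_attaining j (\sum_(p <- s) j (p.1 ⊗ p.2)).
Proof.
move=> js; exists (fun n => (nth (0, 0) s n).1), (fun n => (nth (0, 0) s n).2).
split; last split.
- apply: cvg_seq_bounded; apply/cvg_ex; exists (0 : X * Y)%type.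
  apply: cvg_near_cst.
  near=> n; rewrite nth_default//; near: n; exact: nbhs_infty_ge.
- apply: (series_nth_cvg (F := fun p : X * Y => j (p.1 ⊗ p.2))) => /=.
  apply/eqP; rewrite -normr_le0 (le_trans (projective_le _ _))//.
  by rewrite normr0 mul0r.
- rewrite js; apply: (@series_nth_cvg _ K^o (fun p : X * Y => `|p.1| * `|p.2|)).
  by rewrite /= normr0 mul0r.
Unshelve. all: by end_near. Qed.

Variables (R : realType) (S : real_scalars R K).

Lemma realified_bilinear :
  exists b : {bilinear realified S X -> realified S Y -> realified S Z},
  forall (x : X) (y : Y), b x y = j (x ⊗ y).
Proof.
have jb : @bilinear_for R (realified S X) (realified S Y) (realified S Z)
    *:%R *:%R (fun x y => j ((x : X) ⊗ (y : Y))).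
  split=> [y|x] a v w; rewrite emb_scale.
    by rewrite tensor_linearl linearP.
  by rewrite tensor_linearr linearP.
pose b : {bilinear realified S X -> realified S Y -> realified S Z} :=
  HB.pack (fun (x : realified S X) (y : realified S Y) =>
      j ((x : X) ⊗ (y : Y)) : realified S Z)
    (bilinear_isBilinear.Build R (realified S X) (realified S Y) (realified S Z)
       _ _ _ jb).
by exists b.
Qed.

Lemma projective_dist x y x' y' :
  `|j (x ⊗ y) - j (x' ⊗ y')| <= `|x - x'| * `|y| + `|x'| * `|y - y'|.
Proof.
have -> : j (x ⊗ y) - j (x' ⊗ y') = j ((x - x') ⊗ y) + j (x' ⊗ (y - y')).
  by rewrite tensorBl tensorBr !linearB addrA subrK.
by rewrite (le_trans (ler_normD _ _))// lerD// projective_le.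
Qed.

(** The common form of the two cases. The projections [Q] come from the metric
    π-property in one case; in the other one, the identity is taken for [Q]. *)
Lemma dense_norm_attaining : metric_pi_property X ->
  (forall (s : seq Y) (e : K), 0 < e -> exists Q : {linear Y -> Y},
    [/\ forall y, Q (Q y) = Q y, forall y, `|Q y| <= `|y|,
        maximizing_compact (range Q : set (realified S Y)) &
        forall y, y \in s -> `|y - Q y| < e]) ->
  closure (norm_attaining j) = [set: Z].
Proof.
move=> piX approxY; apply/seteqP; split=> // z _ B /nbhs_ballP[e /= e0 zB].
have e30 : 0 < e / 3 by rewrite divr_gt0.
have [_ [/[swap] -[u _ <-] zu]] : ball z (e / 3) `&` range j !=set0.
  apply: (projective_dense hZ); last exact: ball_open.
  by exists z; exact: ballxx.
have [s us] := tensor_sum u.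
pose C := 1 + \sum_(p <- s) (`|p.1| + `|p.2|).
have C0 : 0 < C by rewrite ltr_pwDl// sumr_ge0// => p _; rewrite addr_ge0.
have d0 : 0 < e / 3 / C by rewrite divr_gt0.
have [P [PP Pc fP sP]] := metric_pi_projection piX (unzip1 s) d0.
have [Q [QQ Qc cQ sQ]] := approxY (unzip2 s) _ d0.
pose w := j (\sum_(p <- s) P p.1 ⊗ Q p.2).
have uw : `|j u - w| <= e / 3.
  rewrite us /w !projective_sum -sumrB.
  apply: (@le_trans _ _ (\sum_(p <- s) e / 3 / C * (`|p.1| + `|p.2|))).
    apply: le_trans (ler_norm_sum _ _ _) _.
    rewrite big_seq [leRHS]big_seq; apply: ler_sum => p ps.
    rewrite (le_trans (projective_dist _ _ _ _))// [_ + `|p.2|]addrC mulrDr lerD//.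
      by rewrite ler_wpM2r// ltW// sP// map_f.
    by rewrite mulrC ler_pM// ltW// sQ// map_f.
  rewrite -mulr_sumr mulrAC ler_pdivrMr// ler_wpM2l ?ltW//.
  by rewrite /C ltrDr.
have [b bE] := realified_bilinear.
have bM x y : `|b x y| <= `|x| * `|y|.
  by rewrite -(ler_emb S) rmorphM !emb_norm bE projective_le.
have MZ (a : R) (x : realified S X) : range P x -> range P (a *: x : realified S X).
  by move=> [x' _ <-]; exists (emb S a *: x') => //; rewrite linearZ.
have NZ (a : R) (y : realified S Y) : range Q y -> range Q (a *: y : realified S Y).
  by move=> [y' _ <-]; exists (emb S a *: y') => //; rewrite linearZ.
have cP : boundedly_compact (range P : set (realified S X)).
  exact/finite_dimensional_boundedly_compact/realified_finite_dimensional.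
have [|s' [ws' s'n]] :=
    near_norm_attaining_sum bM MZ NZ cP cQ (w := w) _ (re_gt0 S e30).
  move=> d d0'; have ed0 : 0 < emb S d by rewrite -(rmorph0 (emb S)) ltr_emb.
  have [r [wr rd]] := projective_cost_lt (\sum_(p <- s) P p.1 ⊗ Q p.2) ed0.
  exists [seq (P p.1, Q p.2) | p <- r]; split.
  - move=> _ /mapP[p _ ->] /=; split; first by exists p.1.
    by exists p.2.
  - rewrite /w big_map.
    under [RHS]eq_bigr do rewrite bE.
    rewrite -projective_sum; congr j.
    (* [P ⊗ Q] fixes [w], since [P] and [Q] are projections. *)
    rewrite -(tensor_map P Q (s := [seq (P p.1, Q p.2) | p <- s]) (t := r)).
      by rewrite big_map /=; apply: eq_bigr => p _; rewrite PP QQ.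
    by rewrite big_map.
  - rewrite -(ltr_emb S) rmorphD emb_norm big_map rmorph_sum /=.
    apply: le_lt_trans rd; apply: ler_sum => p _.
    by rewrite rmorphM !emb_norm ler_pM.
have bs' : \sum_(p <- s') b p.1 p.2 = \sum_(p <- (s' : seq (X * Y))) j (p.1 ⊗ p.2).
  by apply: eq_bigr => p _; rewrite bE.
rewrite bs' in ws' s'n.
exists (\sum_(p <- (s' : seq (X * Y))) j (p.1 ⊗ p.2)); split.
  apply: norm_attaining_sum; rewrite -(emb_norm (S := S)) s'n rmorph_sum.
  by apply: eq_bigr => p _; rewrite rmorphM !emb_norm.
apply: zB; rewrite -ball_normE /=.
move: ws'; rewrite -(ltr_emb S) emb_norm reK ?ltW// => ws'.
rewrite -ball_normE /= in zu.
(* The three distances are those of [z], [j u], [w] and the sum. *)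
have -> : e = e / 3 + (e / 3 + e / 3) by field.
rewrite -(subrK (j u) z) -addrA (le_lt_trans (ler_normD _ _))// ltr_leD//.
rewrite -(subrK w (j u)) -addrA (le_trans (ler_normD _ _))// lerD//.
exact: ltW.
Qed.
End NormAttaining.

Theorem theorem4p8 (R : realType) (K : numFieldType)
    (hK : real_or_complex R K) (X Y Z : completeNormedModType K)
    (j : tensor X Y -> Z) (hZ : is_projective_tensor_product j)
    (hX : metric_pi_property X) :
  (metric_pi_property Y -> closure (norm_attaining j) = [set: Z]) /\
  (uniformly_convex Y -> closure (norm_attaining j) = [set: Z]).
Proof.
have [S] := real_or_complex_scalars hK.
split=> [piY|ucY]; apply: (dense_norm_attaining hZ (S := S)) => // s e e0.
  have [Q [QQ Qc fQ sQ]] := metric_pi_projection piY s e0.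
  exists Q; split => //; apply: boundedly_compact_maximizing.
  exact/finite_dimensional_boundedly_compact/realified_finite_dimensional.
exists (idfun : {linear Y -> Y}); split => // [|y _] /=.
  rewrite image_id; apply: uniformly_convex_maximizing.
  exact: realified_uniformly_convex.
by rewrite subrr normr0.
Qed.
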